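(* Let $N=\{1,\dots,n\}$ index the points to be clustered, let $d(i,j)$ ($i,j\in N$) be a real-valued distance with $d(i,i)=0$, let $k$ with $1\le k\le n$ be the number of clusters, let $G$ be a constant denoting the fewest number of elements permitted in any cluster, let $\lambda$ be a parameter, and run the Adaptive MinMax Starting Method (defined in the context). Consider any iteration $k_o\in\{k,k-1,\dots,1\}$, and let $N_o\subseteq N$ be the set of available points at that iteration (before it is updated), $n_o=|N_o|$. For $i\in N_o$ let $j_1,j_2,\dots,j_{n_o-1}$ (depending on $i$) be the points of $N_o\setminus\{i\}$ in the order of the method's ordered list of $i$, so $d(i,j_1)\le\dots\le d(i,j_{n_o-1})$. For a cluster size $v$, let $C_{best}(v)$ denote a cluster that minimizes $\mathrm{MMSpan}(C)$ over all $C\subseteq N_o$ with $|C|=v$. Let $v^*$ be the best value of $v$, meaning the largest admissible one: $v$ is made as large as possible subject to $v\le\mathrm{MaxScan}+1$ and to $d(i,j_{v-1})\le\mathrm{DistanceLimit}$ for the point $i\in N_o$ from which the cluster is formed; this value is $v^*=\mathrm{BestScan}+1$ for $\mathrm{BestScan}$ at the conclusion of the iteration. Then the cluster $C(k_o)$ and the associated point $i^*$ identified at the conclusion of iteration $k_o$ respectively qualify to be $C_{best}(v^* )$ and its MinMax-centroid; that is, $C(k_o)\subseteq N_o$, $|C(k_o)|=v^*$, $$\mathrm{MMSpan}(C(k_o))=\min\{\mathrm{MMSpan}(C): C\subseteq N_o,\ |C|=v^*\},$$ and $i^*$ is a MinMax-centroid of $C(k_o)$.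
   Context: The distance $d$ is not required to be a metric or to be non-negative; only the convention $d(i,i)=0$ is adopted. For a set $C\subseteq N$ and $i\in C$, put $\mathrm{MaxDist}(i:C)=\max\{d(i,j): j\in C\setminus\{i\}\}$. A MinMax-centroid of $C$ is a point $i^*\in C$ with $\mathrm{MaxDist}(i^*:C)=\min\{\mathrm{MaxDist}(i:C): i\in C\}$, and this minimum value is denoted $\mathrm{MMSpan}(C)$. $\mathit{Large}$ denotes a large positive number. Adaptive MinMax Starting Method. Preprocessing: for each $i\in N$ create an ordering $i(1),i(2),\dots,i(n-1)$ of $N\setminus\{i\}$ with $d(i,i(1))\le d(i,i(2))\le\dots\le d(i,i(n-1))$. Initialize $N_o=N$, $n_o=n$. For $k_o=k,k-1,\dots,1$ do the following. Sizes. Set $\mathrm{MinSize}=\lceil n_o/k_o\rceil$, $\mathrm{MaxSize}=n_o-G\cdot(k_o-1)$, $\mathrm{MinScan}=\mathrm{MinSize}-1$, $\mathrm{MaxScan}=\mathrm{MaxSize}-1$. Phase 1 (assumes that $N_o$ contains at least 2 elements). Set $\mathrm{BestDistance}=\mathit{Large}$ and $\mathrm{BestMinGap}=0$. For each $i\in N_o$: set $\mathrm{MinGap}=\mathit{Large}$, $\mathrm{SumGap}=0$, $\mathrm{Scan}=0$. For $s=1,\dots,n-1$, let $j=i(s)$ and, if $j\in N_o$: increase $\mathrm{Scan}$ by 1; set $\mathrm{Distance}=d(i,j)$; if $\mathrm{Scan}>1$, let $\mathrm{Gap}=\mathrm{Distance}-\mathrm{PreviousDistance}$, add $\mathrm{Gap}$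 to $\mathrm{SumGap}$ and replace $\mathrm{MinGap}$ by $\min(\mathrm{Gap},\mathrm{MinGap})$; if $\mathrm{Scan}=\mathrm{MinScan}$, set $s(i)=s$ and leave the loop over $s$; set $\mathrm{PreviousDistance}=\mathrm{Distance}$. After the loop over $s$, if $\mathrm{Distance}<\mathrm{BestDistance}$, or if $\mathrm{Distance}=\mathrm{BestDistance}$ and $\mathrm{MinGap}>\mathrm{BestMinGap}$, set $\mathrm{BestDistance}=\mathrm{Distance}$, $\mathrm{BestMinGap}=\mathrm{MinGap}$, $\mathrm{BestSumGap}=\mathrm{SumGap}$. After all $i\in N_o$ have been examined, set $\mathrm{BestMeanGap}=\mathrm{BestSumGap}/(\mathrm{MinScan}-1)$, $\mathrm{TargetGap}=\lambda\cdot\mathrm{BestMeanGap}+(1-\lambda)\cdot\mathrm{BestMinGap}$ (suggested default $\lambda=0.3$), and $\mathrm{DistanceLimit}=\mathrm{BestDistance}+\mathrm{TargetGap}$. Phase 2. Reset $\mathrm{BestDistance}=\mathit{Large}$ and set $\mathrm{BestScan}=\mathrm{MinScan}-1$. For each $i\in N_o$: set $\mathrm{Scan}=\mathrm{MinScan}-1$. For $s=s(i),\dots,n-1$, let $j=i(s)$ and, if $j\in N_o$: increase $\mathrm{Scan}$ by 1; if $d(i,j)>\mathrm{DistanceLimit}$, decrease $\mathrm{Scan}$ by 1 and leave the loop over $s$; otherwise set $\mathrm{Distance}=d(i,j)$, and leave the loop if $\mathrm{Scan}=\mathrm{MaxScan}$. After the loop over $s$, if $\mathrm{Scan}\ge\mathrm{MinScan}$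 and either $\mathrm{Scan}>\mathrm{BestScan}$, or $\mathrm{Scan}=\mathrm{BestScan}$ and $\mathrm{Distance}<\mathrm{BestDistance}$, set $i^*=i$, $\mathrm{BestScan}=\mathrm{Scan}$, $\mathrm{BestDistance}=\mathrm{Distance}$. Generate $C(k_o)$ and update $N_o$. Start with $C(k_o)=\emptyset$ and $\mathrm{Scan}=0$. For $s=1,\dots,n-1$, let $j=i^*(s)$ and, if $j\in N_o$, increase $\mathrm{Scan}$ by 1, move $j$ from $N_o$ to $C(k_o)$, and leave the loop if $\mathrm{Scan}=\mathrm{BestScan}$. Then move $i^*$ from $N_o$ to $C(k_o)$, record $i^*$ as the point associated with $C(k_o)$, and replace $n_o$ by $n_o-\mathrm{ClusterSize}$, where $\mathrm{ClusterSize}=\mathrm{BestScan}+1$. (Thus $C(k_o)$ consists of $i^*$ and the first $\mathrm{BestScan}$ points of its ordered list that were in $N_o$.)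
   Formalization: The claim that v* = BestScan+1 is the largest admissible size is stated only when G·k ≤ n (k clusters of at least G points are possible); otherwise MinScan can exceed MaxScan and v* ≤ MaxScan+1 fails, e.g. n=4, k=2, G=3, d=0. *)

(* Defs.v *)
From mathcomp Require Import all_boot all_order all_algebra.
Set Implicit Arguments.
Unset Strict Implicit.
Unset Printing Implicit Defensive.
Import Order.TTheory GRing.Theory Num.Theory.
Local Open Scope ring_scope.

(* The n points are the elements of 'I_n, the real values live
   in an arbitrary real field R, and loop positions s are 1-based. *)

(* Extrema over a finite set, seeded with one of its elements because the values
   may be negative; the value 0 on the empty set is a dummy. *)
Definition set_max (T : finType) (R : realFieldType) (A : {set T}) (f : T -> R) : R :=
  if [pick x in A] is Some x0 then \big[Num.max/f x0]_(x in A) f x else 0.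

Definition set_min (T : finType) (R : realFieldType) (A : {set T}) (f : T -> R) : R :=
  if [pick x in A] is Some x0 then \big[Num.min/f x0]_(x in A) f x else 0.

Section Centroids.

Variables (R : realFieldType) (n : nat) (d : 'I_n -> 'I_n -> R).
Implicit Types (C No : {set 'I_n}) (i : 'I_n).

Definition MaxDist i C : R := set_max (C :\ i) (d i).

Definition MMSpan C : R := set_min C (fun i => MaxDist i C).

Definition MinMax_centroid C i : Prop := i \in C /\ MaxDist i C = MMSpan C.

Definition is_Cbest No (v : nat) C : Prop :=
  [/\ C \subset No, #|C| = v &
      forall C', C' \subset No -> #|C'| = v -> MMSpan C <= MMSpan C'].

End Centroids.

Section Method.

Variables (R : realFieldType) (n : nat) (d : 'I_n -> 'I_n -> R).
(* L i is the ordered list i(1), ..., i(n-1). *)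
Variable L : 'I_n -> seq 'I_n.
Variables (G : nat) (lambda Large : R).
Implicit Types (No : {set 'I_n}) (i j : 'I_n) (js : seq 'I_n).

Definition ordered_lists : Prop :=
  forall i, perm_eq (L i) (enum (predC1 i)) /\
            sorted (fun a b => d i a <= d i b) (L i).

Definition is_large : Prop := 0 < Large /\ forall i j, d i j < Large.

Section Sizes.

Variables (no ko : nat).

(* The ceiling of no / ko. *)
Definition MinSize : nat := ((no + ko.-1) %/ ko)%N.
Definition MinScan : nat := MinSize.-1.
(* Integers, since these are negative when G is too large. *)
Definition MaxSize : int := no%:Z - G%:Z * (ko%:Z - 1).
Definition MaxScan : int := MaxSize - 1.

End Sizes.

Record scan1_state := Scan1 {
  s1_Scan : nat;
  s1_Distance : R;
  s1_PreviousDistance : R;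
  s1_MinGap : R;
  s1_SumGap : R;
  s1_pos : nat (* the recorded s(i) *)
}.

(* The loop over s for a fixed i: js is what is left of L i from position s on. *)
Fixpoint phase1_loop No (minscan : nat) i (s : nat) js (st : scan1_state) :=
  if js is j :: js' then
    if j \in No then
      let Scan := (s1_Scan st).+1 in
      let Distance := d i j in
      let Gap := Distance - s1_PreviousDistance st in
      let SumGap := if (1 < Scan)%N then s1_SumGap st + Gap else s1_SumGap st in
      let MinGap :=
        if (1 < Scan)%N then Num.min Gap (s1_MinGap st) else s1_MinGap st in
      if Scan == minscan then
        Scan1 Scan Distance (s1_PreviousDistance st) MinGap SumGap s
      else phase1_loop No minscan i s.+1 js'
             (Scan1 Scan Distance Distance MinGap SumGap (s1_pos st))
    else phase1_loop No minscan i s.+1 js' st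
  else st.

(* The zeros for Distance, PreviousDistance and s(i) stand for unassigned
   variables; they are overwritten before being read when #|No| >= 2 and
   1 <= minscan < #|No|. *)
Definition phase1_scan No (minscan : nat) i : scan1_state :=
  phase1_loop No minscan i 1 (L i) (Scan1 0 0 0 Large 0 0).

Record best1_state := Best1 {
  b1_BestDistance : R;
  b1_BestMinGap : R;
  b1_BestSumGap : R
}.

Definition phase1_step No (minscan : nat) (b : best1_state) i : best1_state :=
  let r := phase1_scan No minscan i in
  if (s1_Distance r < b1_BestDistance b)
     || (s1_Distance r == b1_BestDistance b) && (b1_BestMinGap b < s1_MinGap r)
  then Best1 (s1_Distance r) (s1_MinGap r) (s1_SumGap r) else b.

(* BestSumGap has no initial value; the 0 is overwritten when Large exceeds
   the distances. *)
Definition phase1 No (minscan : nat) : best1_state :=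
  foldl (phase1_step No minscan) (Best1 Large 0 0) (enum No).

(* If minscan = 1 there is no gap and BestMeanGap is 0 / 0, which is 0 here. *)
Definition DistanceLimit No (minscan : nat) : R :=
  let b := phase1 No minscan in
  let BestMeanGap := b1_BestSumGap b / (minscan%:R - 1) in
  let TargetGap := lambda * BestMeanGap + (1 - lambda) * b1_BestMinGap b in
  b1_BestDistance b + TargetGap.

(* The loop over s for a fixed i; the result is (Scan, Distance). *)
Fixpoint phase2_loop No (maxscan : int) (limit : R) i js (Scan : nat) (Distance : R)
    : nat * R :=
  if js is j :: js' then
    if j \in No then
      if limit < d i j then (Scan, Distance)
      else if (Scan.+1)%:Z == maxscan then (Scan.+1, d i j)
      else phase2_loop No maxscan limit i js' Scan.+1 (d i j)
    else phase2_loop No maxscan limit i js' Scan Distance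
  else (Scan, Distance).

(* The list is resumed at position s(i). The initial Distance 0 is a dummy: it
   is not read unless Scan >= minscan, and then it has been overwritten. *)
Definition phase2_scan No (minscan : nat) (maxscan : int) (limit : R) i : nat * R :=
  phase2_loop No maxscan limit i
    (drop (s1_pos (phase1_scan No minscan i)).-1 (L i)) minscan.-1 0.

Record best2_state := Best2 {
  b2_istar : option 'I_n; (* None until assigned *)
  b2_BestScan : nat;
  b2_BestDistance : R
}.

Definition phase2_step No (minscan : nat) (maxscan : int) (limit : R)
    (b : best2_state) i : best2_state :=
  let: (Scan, Distance) := phase2_scan No minscan maxscan limit i in
  if (minscan <= Scan)%N &&
     ((b2_BestScan b < Scan)%N
      || (Scan == b2_BestScan b) && (Distance < b2_BestDistance b))
  then Best2 (Some i) Scan Distance else b.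

Definition phase2 No (minscan : nat) (maxscan : int) (limit : R) : best2_state :=
  foldl (phase2_step No minscan maxscan limit)
    (Best2 None minscan.-1 Large) (enum No).

(* The result is (C, No). *)
Fixpoint generate_loop (bestscan : nat) js (Scan : nat) (C No : {set 'I_n})
    : {set 'I_n} * {set 'I_n} :=
  if js is j :: js' then
    if j \in No then
      if Scan.+1 == bestscan then (j |: C, No :\ j)
      else generate_loop bestscan js' Scan.+1 (j |: C) (No :\ j)
    else generate_loop bestscan js' Scan C No
  else (C, No).

Definition generate No (bestscan : nat) istar : {set 'I_n} * {set 'I_n} :=
  let: (C, No') := generate_loop bestscan (L istar) 0 set0 No in
  (istar |: C, No' :\ istar).

Record outcome := Outcome {
  out_limit : R;              (* DistanceLimit *)
  out_BestScan : nat;         (* BestScan at the end of the iteration *)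
  out_istar : 'I_n;           (* i^* *)
  out_cluster : {set 'I_n};   (* C(ko) *)
  out_rest : {set 'I_n}       (* the updated No *)
}.

(* The result is None exactly when the iteration is not defined: No has fewer
   than 2 points, or MinScan = 0 (so that no s(i) is recorded), or no point
   qualifies as i^*. The last case cannot occur when 0 <= lambda <= 1 and Large
   exceeds the distances, because then TargetGap >= 0. *)
Definition iteration No (ko : nat) : option outcome :=
  let minscan := MinScan #|No| ko in
  let maxscan := MaxScan #|No| ko in
  if (#|No| < 2)%N || (minscan == 0)%N then None else
  let limit := DistanceLimit No minscan in
  let b := phase2 No minscan maxscan limit in
  if b2_istar b is Some istar then
    let: (C, No') := generate No (b2_BestScan b) istar in
    Some (Outcome limit (b2_BestScan b) istar C No')
  else None.

(* The available points after the first t iterations, ko = k, k-1, ..., k-t+1. *)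
Fixpoint available_after (k t : nat) : option {set 'I_n} :=
  if t is t'.+1 then
    obind (fun No => omap out_rest (iteration No (k - t')%N)) (available_after k t')
  else Some [set: 'I_n].

(* The available points at the start of iteration ko. *)
Definition available (k ko : nat) : option {set 'I_n} := available_after k (k - ko)%N.

(* j_m, for 1 <= m <= #|No| - 1. *)
Definition avail_nth No i (m : nat) : 'I_n := nth i [seq j <- L i | j \in No] m.-1.

Definition admissible No (ko : nat) (limit : R) i (v : nat) : Prop :=
  [/\ (2 <= v <= #|No|)%N, v%:Z <= MaxScan #|No| ko + 1 &
      d i (avail_nth No i v.-1) <= limit].

(* v is the largest admissible size, and it is attained from istar. *)
Definition best_size No (ko : nat) (limit : R) istar (v : nat) : Prop :=
  [/\ istar \in No, admissible No ko limit istar v &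
      forall i v', i \in No -> admissible No ko limit i v' -> (v' <= v)%N].

End Method.

(* Main.v *)
(** Let [i0] be the chosen point [i^*], [b] the final BestScan and [j_b(i)] the
    [b]-th available point in the list of [i].  Any cluster of size [b + 1]
    containing [i] has a point at least as far from [i] as [j_b(i)], and in the
    cluster formed from [i0] the farthest point from [i0] is [j_b(i0)].  So it
    suffices that [d(i0, j_b(i0)) <= d(i, j_b(i))] for every available [i].
    Phase 2 breaks ties in this way among the points whose scan reaches [b]; a
    point whose scan stops earlier was not stopped by MaxScan, so its next
    distance exceeds DistanceLimit, which bounds [d(i0, j_b(i0))].
    The same dichotomy shows that no admissible size exceeds [b + 1].  Only
    [b <= MaxScan] requires MinScan <= MaxScan (otherwise phase 2 starts beyond
    MaxScan and never stops there), which follows from the invariant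
    [n_o >= G k_o]. *)
Require Import Defs.
From mathcomp Require Import all_boot all_order all_algebra.
From mathcomp Require Import zify.
Set Implicit Arguments.
Unset Strict Implicit.
Unset Printing Implicit Defensive.
Import Order.TTheory GRing.Theory Num.Theory.
Local Open Scope ring_scope.

(** * Bounds for maxima and minima over nonempty finite sets *)

Section Extrema.

Variables (T : finType) (R : realFieldType) (f : T -> R).
Implicit Types (A : {set T}) (x : T) (c : R).

Lemma set_max_ge A x : x \in A -> f x <= set_max A f.
Proof.
rewrite /set_max; case: pickP => [x0 _|A0] xA; last by rewrite A0 in xA.
exact: le_bigmax_cond.
Qed.

Lemma set_max_le A c :
  A != set0 -> (forall x, x \in A -> f x <= c) -> set_max A f <= c.
Proof.
case/set0Pn=> y yA Ac; rewrite /set_max; case: pickP => [x0 x0A|A0].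
  by apply: bigmax_le => //; apply: Ac.
by rewrite A0 in yA.
Qed.

Lemma set_min_le A x : x \in A -> set_min A f <= f x.
Proof.
rewrite /set_min; case: pickP => [x0 _|A0] xA; last by rewrite A0 in xA.
exact: bigmin_le_cond.
Qed.

Lemma set_min_ge A c :
  A != set0 -> (forall x, x \in A -> c <= f x) -> c <= set_min A f.
Proof.
case/set0Pn=> y yA Ac; rewrite /set_min; case: pickP => [x0 x0A|A0].
  by apply: le_bigmin => //; apply: Ac.
by rewrite A0 in yA.
Qed.

End Extrema.

(** * Arithmetic of the size bounds *)

Section Sizes.

Variables (no ko : nat).
Hypothesis ko_gt0 : (0 < ko)%N.

Lemma MinSize_le : (MinSize no ko <= no)%N.
Proof.
rewrite /MinSize; have := leq_divM (no + ko.-1) ko.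
by case: no => [|m]; [rewrite add0n divn_small ?prednK|nia].
Qed.

Lemma MinScan_lt : (0 < MinScan no ko)%N -> (MinScan no ko < no)%N.
Proof. by rewrite /MinScan; have := MinSize_le; lia. Qed.

(** Since [G] is an integer, [G * ko <= no] gives [G <= floor(no / ko)]. Reserving [G] points for
    each of the other [ko - 1] clusters therefore leaves at least [ceil(no / ko)] points, which is
    MinSize. *)
Lemma MinScan_le_MaxScan (G : nat) :
  (G * ko <= no)%N -> (0 < MinScan no ko)%N ->
  (MinScan no ko)%:Z <= MaxScan G no ko.
Proof.
move=> Gko; rewrite /MinScan /MaxScan /MaxSize /MinSize.
have := leq_divM (no + ko.-1) ko.
set q := (_ %/ _)%N => qP q_gt1.
nia.
Qed.

End Sizes.

(** * The scanning loops of the two phases *)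

Section Method.

Variables (R : realFieldType) (n : nat) (d : 'I_n -> 'I_n -> R).
Variable L : 'I_n -> seq 'I_n.
Hypothesis L_ordered : ordered_lists d L.
Variables (G : nat) (lambda Large : R).
Implicit Types (No C : {set 'I_n}) (i j : 'I_n) (js : seq 'I_n).

Local Notation avail No js := [seq j <- js | j \in No].

(** Resuming at the recorded position skips exactly the available points before the one that raises
    Scan to [m], so phase 2 starts at the [m]-th available point. The induction needs an arbitrary
    starting position and Scan; the bound on [size] ensures that Scan does reach [m]. *)
Lemma phase1_loop_pos No m i s js st :
  (s1_Scan st < m)%N -> (m - s1_Scan st <= size (avail No js))%N ->
  let r := phase1_loop d No m i s js st in
  (s <= s1_pos r)%N /\
  avail No (drop (s1_pos r - s) js) = drop (m - (s1_Scan st).+1) (avail No js).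
Proof.
elim: js s st => [|j js IH] s st /=; first by lia.
case: ifP => jNo Sm Fm /=.
  case: eqP => [<-|neq] /=; first by rewrite !subnn /= jNo.
  set st' := Scan1 _ _ _ _ _ _.
  have [] := IH s.+1 st'; rewrite /=; try by move: Fm => /=; lia.
  set r := phase1_loop _ _ _ _ _ _ _ => sr IHr; split; first by lia.
  rewrite -(subnSK sr) /= IHr -[in RHS]subnSK //=; lia.
have [] := IH s.+1 st Sm Fm.
set r := phase1_loop _ _ _ _ _ _ _ => sr <-; split; first by lia.
by rewrite -(subnSK sr).
Qed.

(** Here [t] counts the available points accepted by the loop; the prepended [D0] covers [t = 0],
    when no distance is assigned. The test against [maxscan] is an equality and can fire only if the
    scan starts below [maxscan], hence the guards [S0%:Z < maxscan]. *)
Lemma phase2_loopP No maxscan limit i js S0 D0 :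
  let r := phase2_loop d No maxscan limit i js S0 D0 in
  let F := avail No js in
  exists2 t, [/\ r.1 = (S0 + t)%N, r.2 = nth D0 (D0 :: map (d i) F) t
                 & (t <= size F)%N] &
  [/\ (0 < t)%N -> d i (nth i F t.-1) <= limit,
      S0%:Z < maxscan -> (r.1)%:Z <= maxscan &
      (t < size F)%N -> (S0%:Z < maxscan /\ (r.1)%:Z = maxscan)
                        \/ limit < d i (nth i F t)].
Proof.
elim: js S0 D0 => [|j js IH] S0 D0 /=.
  by exists 0%N; rewrite ?addn0 //; split=> //; lia.
case: ifP => jNo //=.
case: ltP => [lt|le] /=.
  by exists 0%N; rewrite ?addn0 //; split=> //; [lia|right].
case: eqP => [eqm|neqm] /=.
  exists 1%N; rewrite ?addn1 //; split=> //; first by lia.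
have [t [-> -> tF] [Dt St Lt]] := IH S0.+1 (d i j).
exists t.+1.
  split; rewrite ?addSnnS //; case: t tF {Dt St Lt} => //= t tF.
  by apply: set_nth_default; rewrite size_map.
split=> [_|Sm|tS].
- by case: t tF Dt {St Lt} => [|t] tF Dt //=; apply: Dt.
- by have := St; move: Sm neqm; lia.
- case: (Lt tS) => [[? ?]|?]; [left; split; lia|by right].
Qed.

(** * Available points in list order, and the cluster generated from them *)

Lemma avail_perm No i : perm_eq (avail No (L i)) (enum (No :\ i)).
Proof.
apply: uniq_perm; rewrite ?enum_uniq //.
  by rewrite filter_uniq // (perm_uniq (L_ordered i).1) enum_uniq.
move=> j; rewrite mem_filter (perm_mem (L_ordered i).1) !mem_enum !inE.
by rewrite andbC.
Qed.

Lemma avail_uniq No i : uniq (avail No (L i)).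
Proof. by rewrite (perm_uniq (avail_perm No i)) enum_uniq. Qed.

Lemma avail_size No i : i \in No -> size (avail No (L i)) = #|No|.-1.
Proof.
by move=> iNo; rewrite (perm_size (avail_perm No i)) -cardE (cardsD1 i No) iNo.
Qed.

Lemma mem_avail No i j : (j \in avail No (L i)) = (j != i) && (j \in No).
Proof. by rewrite (perm_mem (avail_perm No i)) mem_enum !inE. Qed.

Lemma avail_nth_mono No i p q : i \in No -> (0 < p <= q)%N -> (q < #|No|)%N ->
  d i (avail_nth L No i p) <= d i (avail_nth L No i q).
Proof.
move=> iNo pq qNo; rewrite /avail_nth.
have tr : transitive (fun a b => d i a <= d i b) by move=> b a c; apply: le_trans.
apply: (sorted_leq_nth tr) => //; rewrite ?inE ?avail_size //; try lia.
by apply: sorted_filter => //; case: (L_ordered i).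
Qed.

(** Pigeonhole: the [b] points of [C :\ i] cannot all lie among the first [b.-1] available points,
    so one of them has rank at least [b] in the sorted list. *)
Lemma MaxDist_ge No C i b : C \subset No -> i \in C -> (0 < b)%N -> #|C| = b.+1 ->
  d i (avail_nth L No i b) <= MaxDist d i C.
Proof.
move=> CNo iC b_gt0 Cb; have iNo := subsetP CNo i iC.
have bNo : (b < #|No|)%N by rewrite -Cb subset_leq_card.
pose F := avail No (L i).
have [/subset_leq_card|] := boolP (C :\ i \subset take b.-1 F).
  rewrite (card_uniqP (take_uniq b.-1 (avail_uniq No i))).
  rewrite size_take avail_size //.
  move: Cb; rewrite (cardsD1 i C) iC add1n => -[->].
  by case: ifP => ? ?; exfalso; lia.
case/subsetPn=> x xC xF.
have xavail : x \in F.
  by move: xC; rewrite mem_avail !inE => /andP[-> /(subsetP CNo)].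
apply: le_trans (set_max_ge (d i) xC).
rewrite -[X in _ <= d i X](nth_index i xavail).
have ix : (index x F < #|No|.-1)%N by rewrite -(avail_size iNo) index_mem.
apply: (@avail_nth_mono No i b (index x F).+1) => //; last by lia.
rewrite b_gt0 /= leqNgt; apply: contra xF => lt.
rewrite in_take //; lia.
Qed.

Lemma generate_loopP b js S0 C No : uniq js -> (S0 < b)%N ->
  let T := [set j in take (b - S0) (avail No js)] in
  generate_loop b js S0 C No = (T :|: C, No :\: T).
Proof.
elim: js S0 C No => [|j js IH] S0 C No /=.
  by move=> _ _; congr pair; apply/setP=> x; rewrite !inE.
case/andP=> jjs ujs Sb; case: ifP => jNo //=; last exact: IH.
case: eqP => [<-|neq].
  by rewrite subSnn /= take0; congr pair; apply/setP=> x; rewrite !inE.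
have -> : (b - S0 = (b - S0.+1).+1)%N by lia.
(* Moving [j] out of [No] does not disturb the rest of the scan, because the list has no
   duplicates. *)
have Favail : avail (No :\ j) js = avail No js.
  by apply: eq_in_filter => x xjs; rewrite !inE; case: eqP xjs jjs => // -> ->.
rewrite IH ?Favail //=; last by lia.
by congr pair; apply/setP=> x; rewrite !inE; do !case: (_ \in _); case: eqP.
Qed.

Lemma generateP No i b : (0 < b)%N ->
  let C := i |: [set j in take b (avail No (L i))] in
  generate L No b i = (C, No :\: C).
Proof.
move=> b_gt0; rewrite /generate generate_loopP //=; last first.
  by rewrite (perm_uniq (L_ordered i).1) enum_uniq.
by rewrite subn0 setU0; congr pair; apply/setP=> x; rewrite !inE negb_or andbA.
Qed.

(** * Phase 2: scan lengths and the choice of the best point *)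

Section Iteration.

Variables (No : {set 'I_n}) (no m : nat) (maxscan : int) (limit : R).
Hypotheses (card_No : #|No| = no) (m_gt0 : (0 < m)%N) (m_lt : (m < no)%N).

Local Notation jn := (avail_nth L No).
Local Notation scan i := (phase2_scan d L Large No m maxscan limit i).

(** Ranks in the resumed list are shifted by [m.-1] to become ranks among all available points;
    likewise the guard [m.-1 < maxscan] of the loop becomes [m <= maxscan]. *)
Lemma phase2_scanP i : i \in No ->
  [/\ ((scan i).1 < no)%N,
      (m <= (scan i).1)%N ->
        (scan i).2 = d i (jn i (scan i).1) /\ (scan i).2 <= limit,
      m%:Z <= maxscan -> (scan i).1%:Z <= maxscan &
      ((scan i).1.+1 < no)%N ->
        (m%:Z <= maxscan /\ (scan i).1%:Z = maxscan)
        \/ limit < d i (jn i (scan i).1.+1)].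
Proof.
move=> iNo; rewrite /phase2_scan /phase1_scan /avail_nth.
have sF := avail_size iNo; rewrite card_No in sF.
have [] := @phase1_loop_pos No m i 1 (L i) (Scan1 0 0 0 Large 0 0);
  rewrite /= ?sF; try lia.
set p := s1_pos _ => p_gt0 dropF.
have [t] := phase2_loopP No maxscan limit i (drop p.-1 (L i)) m.-1 0.
set r := phase2_loop _ _ _ _ _ _ _ _; rewrite -(subn1 p) {}dropF subn1 size_drop sF.
move=> [-> -> tF] [Dt St Lt]; split; first by lia.
- move=> mt; case: t tF mt Dt {St Lt} => [|t] tF mt Dt /=; first by lia.
  have -> : (m.-1 + t.+1).-1 = (m.-1 + t)%N by lia.
  move: (Dt isT) => /=; rewrite nth_drop => le.
  rewrite (nth_map i) ?size_drop ?sF; last by lia.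
  by rewrite nth_drop.
- by move=> mm; apply: St; lia.
- move=> lt /=; have /Lt : (t < no.-1 - m.-1)%N by lia.
  by rewrite nth_drop => -[[? ?]|?]; [left; split; lia|right].
Qed.

Lemma phase2P i (b := phase2 d L Large No m maxscan limit) :
  b2_istar b = Some i ->
  [/\ i \in No, (m <= b2_BestScan b)%N,
      scan i = (b2_BestScan b, b2_BestDistance b) &
      forall j, j \in No -> ((scan j).1 < b2_BestScan b)%N \/
        (scan j).1 = b2_BestScan b /\ b2_BestDistance b <= (scan j).2].
Proof.
clear no card_No m_lt; rewrite {}/b /phase2.
have : {subset enum No <= No} by move=> j; rewrite mem_enum.
(* The fold invariant must cover the state before any choice: BestScan is then [m.-1], so the first
   scan reaching [m] wins strictly, whatever its Distance. *)
suff inv s : {subset s <= No} ->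
    let b := foldl (phase2_step d L Large No m maxscan limit)
               (Best2 None m.-1 Large) s in
    if b2_istar b is Some i then
    [/\ i \in No, (m <= b2_BestScan b)%N,
      scan i = (b2_BestScan b, b2_BestDistance b) &
      forall j, j \in s -> ((scan j).1 < b2_BestScan b)%N \/
        (scan j).1 = b2_BestScan b /\ b2_BestDistance b <= (scan j).2]
    else b2_BestScan b = m.-1 /\ forall j, j \in s -> ((scan j).1 < m)%N.
  move/inv; case: (foldl _ _ _) => -[i'|] //= B D [? ? ? H] [<-]; split=> //.
  by move=> j jNo; apply: H; rewrite mem_enum.
elim/last_ind: s {i} => [|s x IH] sNo; first by split.
rewrite foldl_rcons.
have xNo : x \in No by apply: sNo; rewrite mem_rcons mem_head.
have {}/IH : {subset s <= No}.
  by move=> j js; apply: sNo; rewrite mem_rcons inE js orbT.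
set b := foldl _ _ _ => /=.
rewrite /phase2_step; case Ex: (phase2_scan _ _ _ _ _ _ _ x) => [S D].
case: ifP => /= [/andP[mS better]|worse]; last first.
  case: (b2_istar b) => [i|] [].
    move=> iNo mB Ei H; split=> // j; rewrite mem_rcons inE.
    case/orP=> [/eqP->|]; last exact: H.
    rewrite Ex /=; move: worse; case: (ltngtP S (b2_BestScan b)) => /= [||SB].
    - by left.
    - by move=> lt; rewrite andbT; lia.
    - rewrite SB mB /= => /negbT; rewrite -leNgt; by right.
  move=> Bm H; split=> // j; rewrite mem_rcons inE => /orP[/eqP->|]; last exact: H.
  rewrite Ex /= ltnNge; apply/negP=> mS; move: worse; rewrite mS Bm /=.
  by have -> : (m.-1 < S)%N by lia.
case: (b2_istar b) => [i|] [].
  move=> iNo mB Ei H; split=> // j; rewrite mem_rcons inE.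
  case/orP=> [/eqP->|/H]; first by rewrite Ex /=; right.
  case: (orP better) => [lt|/andP[/eqP-> ltD]]; first by case=> [?|[? ?]]; left; lia.
  by case=> [|[-> le]]; [left|right; split=> //; apply/ltW/(lt_le_trans ltD)].
move=> Bm H; split=> // j; rewrite mem_rcons inE.
case/orP=> [/eqP->|/H]; first by rewrite Ex /=; right.
by left; lia.
Qed.

End Iteration.

(** * Optimality of the cluster produced by one iteration *)

Section Outcome.

Variables (No : {set 'I_n}) (ko : nat) (out : outcome R n).
Hypothesis ko_gt0 : (0 < ko)%N.
Hypothesis out_iter : iteration d L G lambda Large No ko = Some out.

Local Notation m := (MinScan #|No| ko).
Local Notation maxscan := (MaxScan G #|No| ko).
Local Notation limit := (out_limit out).
Local Notation b := (out_BestScan out).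
Local Notation i0 := (out_istar out).
Local Notation C0 := (out_cluster out).
Local Notation jn := (avail_nth L No).

(** Collects all that is used later about a run. In the last clause, the comparison at rank [b]
    yields minimality of the span, and the one at ranks [s > b] yields maximality of the size. *)
Lemma iterationP :
  [/\ [/\ i0 \in No, (0 < m <= b)%N & (b < #|No|)%N],
      C0 = i0 |: [set j in take b (avail No (L i0))],
      out_rest out = No :\: C0,
      m%:Z <= maxscan -> b%:Z <= maxscan &
      d i0 (jn i0 b) <= limit /\
      forall i, i \in No -> d i0 (jn i0 b) <= d i (jn i b) /\
        forall s, (b < s < #|No|)%N -> s%:Z <= maxscan -> limit < d i (jn i s)].
Proof.
move: out_iter; rewrite /iteration; case: ifP => // /norP/= [].
rewrite -leqNgt -lt0n => No2 m_gt0.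
have m_lt := MinScan_lt ko_gt0 m_gt0.
set lim := DistanceLimit _ _ _ _ _ _.
case Eb: phase2 => [[i|] B D] //=.
have [] := @phase2P No _ (MaxScan G #|No| ko) lim m_gt0 i; rewrite Eb //=.
move=> iNo mB Ei best.
rewrite generateP; last by lia.
case=> <- /=.
have scanP := phase2_scanP maxscan lim (erefl #|No|) m_gt0 m_lt.
have [] := scanP i iNo; rewrite Ei /=.
move=> BNo /(_ mB) [DE Dlim] maxB _; subst D.
split=> //; first by rewrite m_gt0.
split=> // j jNo; split=> [|s /andP[Bs sNo] smax].
  have [_ Dj _ stop] := scanP j jNo.
  case: (best j jNo) => [lt|[Ej le]]; last first.
    by move: Dj; rewrite Ej => /(_ mB) [<- _].
  have /stop[[mmax Emax]|far] := leq_ltn_trans lt BNo.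
    (* A stop at MaxScan itself provides [m <= maxscan], so [maxB] bounds the best scan by MaxScan,
       which is the strictly shorter scan of [j]: a contradiction. *)
    by have := maxB mmax; rewrite -{}Emax lez_nat leqNgt lt.
  apply: (le_trans Dlim); apply: (le_trans (ltW far)).
  by apply: avail_nth_mono => //; rewrite lt.
have [_ _ _ stop] := scanP j jNo.
have lt : ((phase2_scan d L Large No m maxscan lim j).1 < s)%N.
  by case: (best j jNo) => [lt|[-> _]] //; apply: ltn_trans Bs.
have /stop[[mmax Emax]|far] := leq_ltn_trans lt sNo.
  by move: smax; rewrite -{}Emax lez_nat leqNgt lt.
apply: (lt_le_trans far).
by apply: avail_nth_mono => //; rewrite lt.
Qed.

Lemma out_cluster_sub : C0 \subset No.
Proof.
have [[iNo _ _] -> _ _ _] := iterationP.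
apply/subsetP=> x; rewrite !inE => /orP[/eqP->//|/mem_take].
by rewrite mem_avail => /andP[].
Qed.

Lemma card_out_cluster : #|C0| = b.+1.
Proof.
have [[iNo _ bNo] -> _ _ _] := iterationP.
rewrite cardsU1 inE; have -> : i0 \notin take b (avail No (L i0)).
  by apply/negP=> /mem_take; rewrite mem_avail eqxx.
rewrite cardsE (card_uniqP (take_uniq _ (avail_uniq No i0))) size_takel //.
by rewrite avail_size // -ltnS (ltn_predK bNo).
Qed.

(** One inequality is the general bound [MaxDist_ge]; for the other, every point of [C0] except [i0]
    has rank at most [b] in the sorted list. *)
Lemma MaxDist_out_cluster : MaxDist d i0 C0 = d i0 (jn i0 b).
Proof.
have [[iNo /andP[m_gt0 mb] bNo] C0E _ _ _] := iterationP.
have b_gt0 := leq_trans m_gt0 mb.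
have iC : i0 \in C0 by rewrite C0E !inE eqxx.
apply/eqP; rewrite eq_le (MaxDist_ge out_cluster_sub iC b_gt0 card_out_cluster).
rewrite andbT; apply: set_max_le => [|x].
  rewrite -card_gt0; move: card_out_cluster; rewrite (cardsD1 i0) iC add1n.
  by case=> ->.
rewrite C0E !inE; case: eqP => //= _ xT.
have xF := mem_take xT; move: xT; rewrite in_take_leq; last first.
  by rewrite avail_size // -ltnS (ltn_predK bNo).
move=> ix; rewrite -[X in d _ X](nth_index i0 xF).
by apply: (@avail_nth_mono No i0 (index x (avail No (L i0))).+1 b) => //; rewrite ix.
Qed.

Lemma MMSpan_ge C : C \subset No -> #|C| = b.+1 ->
  d i0 (jn i0 b) <= MMSpan d C.
Proof.
have [[iNo /andP[m_gt0 mb] bNo] _ _ _ [_ best]] := iterationP.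
move=> CNo Cb; apply: set_min_ge => [|i iC]; first by rewrite -card_gt0 Cb.
have [le _] := best i (subsetP CNo i iC).
exact: le_trans le (MaxDist_ge CNo iC (leq_trans m_gt0 mb) Cb).
Qed.

Lemma MMSpan_out_cluster : i0 \in C0 /\ MMSpan d C0 = d i0 (jn i0 b).
Proof.
have iC : i0 \in C0 by have [_ -> _ _ _] := iterationP; rewrite !inE eqxx.
split=> //; apply/eqP; rewrite eq_le (MMSpan_ge out_cluster_sub card_out_cluster).
by rewrite andbT -MaxDist_out_cluster; apply: set_min_le.
Qed.

Lemma out_best_size : (G * ko <= #|No|)%N ->
  best_size d L G No ko limit i0 b.+1.
Proof.
move=> Gko.
have [[iNo /andP[m_gt0 mb] bNo] _ _ maxb [le best]] := iterationP.
have mmax := MinScan_le_MaxScan ko_gt0 Gko m_gt0.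
split=> // [|i v iN [/andP[v2 vNo] vmax dv]].
  by split=> //; [rewrite ltnS (leq_trans m_gt0 mb)|move: (maxb mmax); lia].
rewrite leqNgt; apply/negP=> bv; have [_ far] := best i iN.
(* Size [v] corresponds to rank [v.-1], so a size above [b.+1] would need a rank above [b], where
   the distance exceeds the limit. *)
have /far : (b < v.-1 < #|No|)%N.
  by rewrite -ltnS (ltn_predK v2) bv /= (leq_trans _ vNo) // (ltn_predK v2).
by rewrite ltNge dv => H; have : false by apply: H; move: vmax v2; lia.
Qed.

(** MaxSize keeps [G] points back for each of the remaining [ko - 1] clusters, so the invariant
    passes to the next iteration once [b <= maxscan] is known. *)
Lemma out_rest_size : (G * ko <= #|No|)%N -> (G * ko.-1 <= #|out_rest out|)%N.
Proof.
move=> Gko; have [[_ /andP[m_gt0 mb] bNo] _ -> maxb _] := iterationP.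
rewrite cardsD (setIidPr out_cluster_sub) card_out_cluster.
have := maxb (MinScan_le_MaxScan ko_gt0 Gko m_gt0).
rewrite /MaxScan /MaxSize.
move: bNo; move: #|No| => no bNo.
nia.
Qed.

End Outcome.

Lemma available_size k t No : (G * k <= n)%N -> (t <= k)%N ->
  available_after d L G lambda Large k t = Some No -> (G * (k - t) <= #|No|)%N.
Proof.
move=> Gk; elim: t No => [|t IH] No tk /=.
  by case=> <-; rewrite cardsT card_ord subn0.
case E: available_after => [No'|] //=.
case E': iteration => [out|] //= [<-].
rewrite subnS; apply: (out_rest_size _ E'); first by rewrite subn_gt0.
by apply: IH => //; apply: ltnW.
Qed.

End Method.

Theorem theorem2 (R : realFieldType) (n : nat) (d : 'I_n -> 'I_n -> R)
    (d_diag : forall i, d i i = 0)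
    (k : nat) (k_range : (1 <= k <= n)%N)
    (G : nat) (lambda Large : R) (Large_large : is_large d Large)
    (L : 'I_n -> seq 'I_n) (L_ordered : ordered_lists d L)
    (ko : nat) (ko_range : (1 <= ko <= k)%N)
    (No : {set 'I_n}) (No_avail : available d L G lambda Large k ko = Some No)
    (out : outcome R n) (out_iter : iteration d L G lambda Large No ko = Some out) :
  let v := (out_BestScan out).+1 in
  [/\ (G * k <= n)%N -> best_size d L G No ko (out_limit out) (out_istar out) v,
      is_Cbest d No v (out_cluster out) &
      MinMax_centroid d (out_cluster out) (out_istar out)].
Proof.
case/andP: ko_range => ko_gt0 ko_le.
have [iC spanE] := MMSpan_out_cluster L_ordered ko_gt0 out_iter.
split=> [Gk||].
- apply: (out_best_size L_ordered ko_gt0 out_iter).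
  have := available_size L_ordered Gk (leq_subr ko k) No_avail.
  by rewrite subKn.
- split=> [||C CNo Cv].
  + exact: (out_cluster_sub L_ordered ko_gt0 out_iter).
  + exact: (card_out_cluster L_ordered ko_gt0 out_iter).
  + by rewrite spanE; apply: (MMSpan_ge L_ordered ko_gt0 out_iter).
- split=> //; rewrite spanE.
  exact: (MaxDist_out_cluster L_ordered ko_gt0 out_iter).
Qed.
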